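(* Let $\mu$ be a probability measure on a space $X$, let $a \le 0 \le b$ be real constants, and let $m\in(0,1]$. If $f: X \rightarrow [a,b]$ is a measurable function and $\varphi:[a,b]\to\mathbb{R}$ is a continuous $m$-convex function on $[a,b]$, then $f$ and $\varphi(mf)$ (the function $x\mapsto \varphi(m f(x))$) are $\mu$-integrable and $$ \varphi \Big( ma+m^{2}b -m^{2} \int _{X} f\,d\mu \Big) \le m\varphi(a) + m^{2}\varphi(b) -m \int _{X}\varphi (mf)\,d\mu . $$ Moreover, if $m=1$, this inequality also holds without the hypothesis $0 \in [a,b]$, that is, for arbitrary real constants $a\le b$.
   Context: Let $I\subseteq \mathbb{R}$ be an interval containing $0$ and let $m\in (0,1]$. A function $\varphi:I \rightarrow \mathbb{R}$ is called $m$-convex if $$\varphi(t x+m(1-t) y) \leq t \varphi(x)+m(1-t) \varphi(y)$$ for all $x,y\in I$ and all $t\in [0,1]$. For $m=1$ this is ordinary convexity on $I$, and in that case the requirement $0\in I$ is not needed for the definition. *)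

(* Defs.v *)
From HB Require Import structures.
From mathcomp Require Import all_boot all_order all_algebra.
From mathcomp Require Import all_classical all_reals all_analysis.

Set Implicit Arguments.
Unset Strict Implicit.
Unset Printing Implicit Defensive.

Import Order.TTheory GRing.Theory Num.Theory.
Import numFieldNormedType.Exports.

Local Open Scope ring_scope.

(* A function on I is represented by a total function R -> R of which only the
   values on I matter.  The definition is meant for 0 < m <= 1 and, unless
   m = 1, for 0 \in I: then t * x + m * (1 - t) * y lies in I again. *)
Definition m_convex (R : realType) (I : interval R) (m : R) (phi : R -> R) :
    Prop :=
  forall x y t : R, x \in I -> y \in I -> 0 <= t <= 1 ->
    phi (t * x + m * (1 - t) * y) <= t * phi x + m * (1 - t) * phi y.

(* Main.v *)
(** For [y = t a + (1 - t) b], m-convexity bounds [phi (m y)] by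
    [m t phi(a) + m (1 - t) phi(b)], which is affine in [y]; this bound can be
    integrated, giving [m T phi(a) + m (1 - T) phi(b)] where [T] is the weight
    of the mean of [f]. With the same [T], the argument of [phi] on the left
    hand side is [t x + m (1 - t) a] for [t = T] and [x = m (m b + (1 - m) a)],
    and [phi] is bounded there by
    [m (1 - T) phi(a) + T (m (1 - m) phi(a) + m^2 phi(b))].
    Adding the two bounds gives the inequality. Jensen's inequality, which may
    fail for m-convex functions, is not involved. *)
Require Import Defs.
From HB Require Import structures.
From mathcomp Require Import all_boot all_order all_algebra.
From mathcomp Require Import all_classical all_reals all_analysis.
From mathcomp Require Import measurable_realfun ring lra.

Set Implicit Arguments.
Unset Strict Implicit.
Unset Printing Implicit Defensive.

Import Order.TTheory GRing.Theory Num.Theory.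
Import numFieldNormedType.Exports.

Local Open Scope classical_set_scope.
Local Open Scope ring_scope.

Lemma m_convex_scale (R : realType) (I : interval R) (m : R) (phi : R -> R)
    (y : R) : m_convex I m phi -> y \in I -> phi (m * y) <= m * phi y.
Proof.
move=> cvx yI; have := cvx y y 0 yI yI; rewrite lexx ler01 => /(_ isT).
by rewrite !mul0r !add0r subr0 !mulr1.
Qed.

(** The point splits as [t * (m * x) + m * (1 - t) * y], so m-convexity applies to [m * x] and [y];
    scaling then bounds [phi (m * x)] by [m * phi x]. *)
Lemma m_convex_chord (R : realType) (I : interval R) (m : R) (phi : R -> R)
    (x y t : R) :
  m_convex I m phi -> x \in I -> y \in I -> m * x \in I -> 0 <= t <= 1 ->
  phi (m * (t * x + (1 - t) * y)) <= m * (t * phi x + (1 - t) * phi y).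
Proof.
move=> cvx xI yI mxI t01; have /andP[t0 _] := t01.
have -> : m * (t * x + (1 - t) * y) = t * (m * x) + m * (1 - t) * y by ring.
apply: le_trans (cvx _ _ _ mxI yI t01) _.
have := ler_wpM2l t0 (m_convex_scale cvx xI); lra.
Qed.

(** Two bounds are nested: m-convexity at [m * (m * b + (1 - m) * a)] and [a] with weight [t], then
    the chord bound from [b] to [a], in which [m] itself serves as the weight. *)
Lemma m_convex_reflected_chord (R : realType) (I : interval R) (m : R)
    (phi : R -> R) (a b t : R) :
  0 <= m <= 1 -> m_convex I m phi -> a \in I -> b \in I -> m * b \in I ->
  m * (m * b + (1 - m) * a) \in I -> 0 <= t <= 1 ->
  phi (m * a + m ^+ 2 * b - m ^+ 2 * (t * a + (1 - t) * b)) <=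
    m * (1 - t) * phi a + t * (m * ((1 - m) * phi a + m * phi b)).
Proof.
move=> m01 cvx aI bI mbI cI t01; have /andP[t0 _] := t01.
have -> : m * a + m ^+ 2 * b - m ^+ 2 * (t * a + (1 - t) * b) =
  t * (m * (m * b + (1 - m) * a)) + m * (1 - t) * a by ring.
apply: le_trans (cvx _ _ _ cI aI t01) _.
have := ler_wpM2l t0 (m_convex_chord cvx bI aI mbI m01); lra.
Qed.

Lemma segment_weight (R : realFieldType) (a b y : R) :
  y \in `[a, b] ->
  let t := (b - y) / (b - a) in
  0 <= t <= 1 /\ y = t * a + (1 - t) * b.
Proof.
rewrite in_itv /= => /andP[ay yb].
have [eq_ba|ba] := eqVneq (b - a) 0.
  (* If [a = b], division by zero makes the weight 0, and [y = b] is the only point. *)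
  by rewrite eq_ba invr0 mulr0 lexx ler01; split=> //; lra.
have ba0 : 0 < b - a by rewrite lt_def ba /=; lra.
split; last by field.
by rewrite ler_pdivrMr // divr_ge0 /=; lra.
Qed.

Section probability_integral.
Context {d : measure_display} {X : measurableType d} {R : realType}.

(** A continuous function on a compact segment is bounded and measurable there, so the composite is
    bounded and measurable, hence integrable for a finite measure. *)
Lemma integrable_comp_within_continuous (mu : {finite_measure set X -> \bar R})
    (a b : R) (f : X -> R) (g : R -> R) :
  measurable_fun [set: X] f -> (forall x, f x \in `[a, b]) ->
  {within `[a, b], continuous g} ->
  mu.-integrable [set: X] (EFin \o (g \o f)).
Proof.
move=> mf fab cg; apply: measurable_bounded_integrable => //.
- by rewrite ltey_eq fin_num_measure.
- apply: (@measurable_comp _ _ _ _ _ _ `[a, b]) => //.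
    by move=> _ [x _ <-]; exact: fab.
  exact: subspace_continuous_measurable_fun.
- have /compact_bounded[M [_ gM]] := continuous_compact cg (@segment_compact _ a b).
  exists M; split; rewrite ?num_real// => r Mr x _.
  by apply: gM => //; exists (f x) => //; exact: fab.
Qed.

Lemma Rintegral_affine (mu : probability X R) (f : X -> R) (p q : R) :
  mu.-integrable [set: X] (EFin \o f) ->
  mu.-integrable [set: X] (EFin \o (fun x => p + q * f x)) /\
  \int[mu]_x (p + q * f x) = p + q * \int[mu]_x f x.
Proof.
move=> fi.
have ci : mu.-integrable [set: X] (EFin \o cst p).
  exact: finite_measure_integrable_cst.
have qi : mu.-integrable [set: X] (EFin \o (fun x => q * f x)).
  exact: (integrableZl measurableT q fi).
split; first exact: (integrableD measurableT ci qi).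
have := RintegralD measurableT ci qi; rewrite /= => ->.
by rewrite RintegralZl //= Rintegral_cst //= probability_setT /= mulr1.
Qed.

Lemma le_Rintegral_affine (mu : probability X R) (f g : X -> R) (p q : R) :
  mu.-integrable [set: X] (EFin \o f) -> mu.-integrable [set: X] (EFin \o g) ->
  (forall x, g x <= p + q * f x) ->
  \int[mu]_x g x <= p + q * \int[mu]_x f x.
Proof.
move=> fi gi gle; have [li <-] := Rintegral_affine p q fi.
by apply: le_Rintegral.
Qed.

(** This allows the mean of [f] to be written as a convex combination of [a] and [b]. *)
Lemma Rintegral_in_itv (mu : probability X R) (f : X -> R) (a b : R) :
  mu.-integrable [set: X] (EFin \o f) -> (forall x, f x \in `[a, b]) ->
  \int[mu]_x f x \in `[a, b].
Proof.
move=> fi fab.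
have mean r : \int[mu]_(x in [set: X]) r = r.
  by rewrite Rintegral_cst //= probability_setT mulr1.
have ci r : mu.-integrable [set: X] (EFin \o cst r).
  exact: finite_measure_integrable_cst.
rewrite in_itv /=; apply/andP; split.
- rewrite -[leLHS]mean; apply: le_Rintegral => // [|x _]; first exact: ci.
  by have := fab x; rewrite in_itv /= => /andP[].
- rewrite -[leRHS]mean; apply: le_Rintegral => // [|x _]; first exact: ci.
  by have := fab x; rewrite in_itv /= => /andP[].
Qed.

End probability_integral.

(** The hypotheses on [m * a] and [m * b] follow both from [a <= 0 <= b] and from [m = 1], so one
    argument serves both halves of the theorem. *)
Lemma m_convex_Jensen_Mercer (R : realType) (d : measure_display)
    (X : measurableType d) (mu : probability X R) (a b m : R) (f : X -> R)
    (phi : R -> R) :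
  a <= b -> 0 < m <= 1 -> m * a \in `[a, b] -> m * b \in `[a, b] ->
  measurable_fun [set: X] f -> (forall x, f x \in `[a, b]) ->
  {within `[a, b], continuous phi} -> m_convex `[a, b] m phi ->
  [/\ mu.-integrable [set: X] (fun x => (f x)%:E),
      mu.-integrable [set: X] (fun x => (phi (m * f x))%:E) &
      phi (m * a + m ^+ 2 * b - m ^+ 2 * \int[mu]_x f x)
        <= m * phi a + m ^+ 2 * phi b - m * \int[mu]_x phi (m * f x)].
Proof.
move=> ab /andP[m0 m1] maI mbI mf fab cphi cvx.
have aI : a \in `[a, b] by rewrite in_itv /= lexx ab.
have bI : b \in `[a, b] by rewrite in_itv /= lexx ab.
have mI y : y \in `[a, b] -> m * y \in `[a, b].
  move: maI mbI; rewrite !in_itv /= => /andP[ama _] /andP[_ mbb] /andP[ay yb].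
  by rewrite (le_trans ama) ?(le_trans _ mbb) // ler_pM2l.
have fi : mu.-integrable [set: X] (EFin \o f).
  apply: (@integrable_comp_within_continuous _ _ _ mu a b f id) => //.
  by apply: continuous_subspaceT => x; exact: cvg_id.
have gi : mu.-integrable [set: X] (EFin \o (fun x => phi (m * f x))).
  apply: (@integrable_comp_within_continuous _ _ _ mu a b (fun x => m * f x)) => //.
    exact: measurable_funM.
  by move=> x; exact: mI.
split=> //.
have cI : m * b + (1 - m) * a \in `[a, b] by rewrite in_itv /=; nra.
have [] := segment_weight (Rintegral_in_itv fi fab).
set T := (b - \int[mu]_x f x) / (b - a) => T01 FE.
have lhs := m_convex_reflected_chord _ cvx aI bI mbI (mI _ cI) T01.
rewrite [in leLHS]FE; apply: le_trans (lhs _) _; first by rewrite ltW.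
(* [q] is the slope of the chord bound seen as an affine function of the point [y], with value
   [m * phi b] at [y = b]. *)
pose q := m * (phi b - phi a) / (b - a).
have := @le_Rintegral_affine _ _ _ mu f _ (m * phi b - q * b) q fi gi.
(* The identity treats the inverse of [b - a] as an opaque factor, so it also covers [a = b]. *)
have affE y : m * phi b - q * b + q * y =
    m * (((b - y) / (b - a)) * phi a + (1 - (b - y) / (b - a)) * phi b).
  by rewrite /q; ring.
rewrite affE -/T => intle.
have {}intle : \int[mu]_x phi (m * f x) <= m * (T * phi a + (1 - T) * phi b).
  apply: intle => x; rewrite affE.
  have [] := segment_weight (fab x).
  set t := (b - f x) / (b - a) => t01 {1}->.
  exact: (m_convex_chord cvx aI bI maI t01).
(* Once the integral bound is multiplied by [m], the terms in [T] cancel in the sum, leaving the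
   coefficients [m] of [phi a] and [m ^+ 2] of [phi b]. *)
have := ler_wpM2l (ltW m0) intle; lra.
Qed.

Theorem theorem14 (R : realType) (d : measure_display) (X : measurableType d)
    (mu : probability X R) :
  (forall (a b m : R) (f : X -> R) (phi : R -> R),
     a <= 0 -> 0 <= b -> 0 < m <= 1 ->
     measurable_fun [set: X] f ->
     (forall x : X, f x \in `[a, b]) ->
     {within `[a, b], continuous phi} ->
     m_convex `[a, b] m phi ->
     [/\ mu.-integrable [set: X] (fun x => (f x)%:E),
         mu.-integrable [set: X] (fun x => (phi (m * f x))%:E) &
         phi (m * a + m ^+ 2 * b - m ^+ 2 * \int[mu]_x f x)
           <= m * phi a + m ^+ 2 * phi b - m * \int[mu]_x phi (m * f x)])
  /\
  (forall (a b m : R) (f : X -> R) (phi : R -> R),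
     a <= b -> m = 1 ->
     measurable_fun [set: X] f ->
     (forall x : X, f x \in `[a, b]) ->
     {within `[a, b], continuous phi} ->
     m_convex `[a, b] m phi ->
     [/\ mu.-integrable [set: X] (fun x => (f x)%:E),
         mu.-integrable [set: X] (fun x => (phi (m * f x))%:E) &
         phi (m * a + m ^+ 2 * b - m ^+ 2 * \int[mu]_x f x)
           <= m * phi a + m ^+ 2 * phi b - m * \int[mu]_x phi (m * f x)]).
Proof.
split=> a b m f phi.
- move=> a0 b0 m01 mf fab cphi cvx; have /andP[m0 m1] := m01.
  apply: m_convex_Jensen_Mercer => //; first exact: le_trans a0 b0.
    by rewrite in_itv /=; nra.
  by rewrite in_itv /=; nra.
- move=> ab -> mf fab cphi cvx.
  by apply: m_convex_Jensen_Mercer; rewrite ?ltr01 ?mul1r ?in_itv /= ?lexx ?ab.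
Qed.
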